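(* Consider a discrete memoryless semantic communication channel with finite alphabets $\mathcal{S}$ (semantic code symbols), $\mathcal{X}$ (physical channel inputs) and $\mathcal{Y}$ (physical channel outputs), in which the semantic noise is caused only by physical channel noise, the physical channel being the discrete memoryless channel with transition probabilities $p(y|x)$, $x\in\mathcal{X}$, $y\in\mathcal{Y}$, and in which the semantic channel is noiseless (the full codebook is known to both transmitter and receiver). Let $p(s)$ be any probability mass function on $\mathcal{S}$ and $p(x|s)$ any conditional probability mass function on $\mathcal{X}$ given $\mathcal{S}$, and let $(S,X,Y)$ have joint probability mass function $p(s)\,p(x|s)\,p(y|x)$. Then the following rate region is achievable: all pairs $(R,R')$ of nonnegative real numbers satisfying $$R\leq I(S;Y),\qquad R'\leq H(X|S),$$ where $R$ is the semantic rate and $R'$ is the rate of the messages expressing each semantic.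
   Context: All entropies and mutual informations are in bits; $H(X|S)$ is conditional entropy and $I(S;Y)$ is mutual information. Over $n$ channel uses, the memoryless physical channel acts as $p(y^n|x^n)=\prod_{i=1}^n p(y_i|x_i)$. The context (side information that makes each message at the transmitter have a single meaning) is fixed and known at both ends, so it is suppressed from the notation. A $(2^{nR},2^{nR'},n)$ code (numbers of codewords are rounded to integers when necessary) consists of: 1. a semantic set $\mathcal{W}=\{1,\dots,2^{nR}\}$; 2. a semantic encoding function $f_1:\mathcal{W}\to\mathcal{S}^n$, $w\mapsto s^n(w)$; 3. a channel encoding $f_2$ from $\mathcal{S}^n$ to $\mathcal{X}^n$: each semantic codeword $s^n(w)$ is associated with $2^{nR'}$ channel codewords $x^n(w,1),\dots,x^n(w,2^{nR'})$, one for each of the $2^{nR'}$ messages expressing the semantic $w$ (the total of $2^{n(R+R')}$ messages is partitioned into $2^{nR}$ subsets of size $2^{nR'}$, one subset per semantic). To transmit $w$, the sender picks $m\in\{1,\dots,2^{nR'}\}$ uniformly at random and sends $x^n(w,m)$ over the physical channel; 4. a decoding function $g:\mathcal{Y}^n\to\mathcal{W}$. The receiver only has to recover the semantic $w$, not the message index $m$. The semantic $w$ is uniformly distributed on $\mathcal{W}$, and the average probability of error is $$P_e^{(n)}=2^{-nR}\sum_{w=1}^{2^{nR}}P\big(g(Y^n)\neq w\mid w\text{ is sent}\big),$$ where the probability is over the random choice of $m$ and the channel noise. A pair $(R,R')$ is achieved by a sequence of $(2^{nR},2^{nR'},n)$ codes if $P_e^{(n)}\to 0$ as $n\to\infty$.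 As is usual in information theory, a rate region is called achievable if each of its points lies in the closure of the set of pairs $(R,R')$ that are achieved by such sequences of codes. *)

(* Defs.v *)
From HB Require Import structures.
From mathcomp Require Import all_boot all_order all_algebra.
From mathcomp Require Import all_classical all_reals all_analysis.

Set Implicit Arguments.
Unset Strict Implicit.
Unset Printing Implicit Defensive.

Import Order.TTheory GRing.Theory Num.Theory.
Import numFieldNormedType.Exports.

Local Open Scope classical_set_scope.
Local Open Scope ring_scope.

Definition is_pmf (R : realType) (A : finType) (p : A -> R) : Prop :=
  (forall a, 0 <= p a) /\ \sum_a p a = 1.

Definition log2 (R : realType) (x : R) : R := ln x / ln 2.

Definition marg1 (R : realType) (A B : finType) (p : A -> B -> R) (a : A) : R :=
  \sum_b p a b.

Definition marg2 (R : realType) (A B : finType) (p : A -> B -> R) (b : B) : R :=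
  \sum_a p a b.

(* H(B|A) and I(A;B) in bits, for a joint pmf p on A * B.  The convention
   0 log 0 = 0 is automatic: wherever an argument of log2 below is degenerate
   (a zero numerator or denominator), the factor p a b vanishes. *)
Definition cond_entropy (R : realType) (A B : finType) (p : A -> B -> R) : R :=
  - \sum_a \sum_b p a b * log2 (p a b / marg1 p a).

Definition mutual_info (R : realType) (A B : finType) (p : A -> B -> R) : R :=
  \sum_a \sum_b p a b * log2 (p a b / (marg1 p a * marg2 p b)).

Section Joint.
Variables (R : realType) (S X Y : finType).
Variables (pS : S -> R) (pX_S : S -> X -> R) (pY_X : X -> Y -> R).

Definition joint (s : S) (x : X) (y : Y) : R := pS s * pX_S s x * pY_X x y.

Definition joint_SX (s : S) (x : X) : R := \sum_y joint s x y.

Definition joint_SY (s : S) (y : Y) : R := \sum_x joint s x y.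

End Joint.

Definition dmc_ext (R : realType) (X Y : finType) (pY_X : X -> Y -> R) (n : nat)
    (x : {ffun 'I_n -> X}) (y : {ffun 'I_n -> Y}) : R :=
  \prod_(i < n) pY_X (x i) (y i).

(* A code with M semantics and M' messages per semantic; x^n(w, m) is
   [chan_enc (sem_enc w) m].  The M' channel codewords associated with a
   semantic codeword are pairwise distinct: with repetitions allowed, M' would
   not be a number of codewords and the rate R' would be unconstrained. *)
Record code (S X Y : finType) (M M' n : nat) := Code {
  sem_enc : 'I_M -> {ffun 'I_n -> S} ;
  chan_enc : {ffun 'I_n -> S} -> 'I_M' -> {ffun 'I_n -> X} ;
  decode : {ffun 'I_n -> Y} -> 'I_M ;
  chan_enc_inj : forall w, injective (chan_enc (sem_enc w))
}.

Definition codeword (S X Y : finType) (M M' n : nat) (c : code S X Y M M' n)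
    (w : 'I_M) (m : 'I_M') : {ffun 'I_n -> X} :=
  chan_enc c (sem_enc c w) m.

(* P(g(Y^n) <> w | w is sent), the message m being uniform on 'I_M'. *)
Definition err_given (R : realType) (S X Y : finType) (pY_X : X -> Y -> R)
    (M M' n : nat) (c : code S X Y M M' n) (w : 'I_M) : R :=
  M'%:R^-1 * \sum_(m < M')
    \sum_(y : {ffun 'I_n -> Y} | decode c y != w) dmc_ext pY_X (codeword c w m) y.

Definition avg_err (R : realType) (S X Y : finType) (pY_X : X -> Y -> R)
    (M M' n : nat) (c : code S X Y M M' n) : R :=
  M%:R^-1 * \sum_(w < M) err_given pY_X c w.

(* 2^(n r), rounded up. *)
Definition ncodewords (R : realType) (r : R) (n : nat) : nat :=
  `|Num.ceil (2 `^ (n%:R * r))|%N.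

Definition achieved (R : realType) (S X Y : finType) (pY_X : X -> Y -> R) :
    set (R * R) :=
  [set r | [/\ 0 <= r.1, 0 <= r.2 &
    exists c : forall n, code S X Y (ncodewords r.1 n) (ncodewords r.2 n) n,
      (fun n => avg_err pY_X (c n)) @ \oo --> (0 : R)]].

Definition achievable_region (R : realType) (S X Y : finType)
    (pY_X : X -> Y -> R) (A : set (R * R)) : Prop :=
  A `<=` closure (achieved S pY_X).

(* Main.v *)
(** Feinstein's greedy construction, applied to the induced channel
    p(y|s) = sum_x p(x|s) p(y|x), picks semantic codewords s^n(w) with disjoint
    decoding sets and uniformly small error; it can be restricted to those s^n
    for which p(x^n|s^n) is concentrated on sequences of probability at most
    2^(-nc), with c < H(X|S).  The error of a fixed w averaged over
    x^n ~ p(.|s^n(w)) is at most lam, so by Markov's inequality at least half of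
    the conditional probability sits on sequences x^n with error at most 2 lam.
    Since almost every single x^n has probability at most 2^(-nc), there are at
    least 2^(nc)/4 such sequences, and any 2^(nR') distinct ones serve as the
    channel codewords of w.  A Chernoff bound replaces the law of large numbers,
    so all error terms decay geometrically. *)

From Pilot Require Import Defs.
From HB Require Import structures.
From mathcomp Require Import all_boot all_order all_algebra.
From mathcomp Require Import all_classical all_reals all_analysis.
From mathcomp Require Import ring lra.

Import Order.TTheory GRing.Theory Num.Theory.
Import numFieldNormedType.Exports.
(* The libraries above shadow [code] and [decode]. *)
Import Pilot.Defs.

Local Open Scope classical_set_scope.
Local Open Scope ring_scope.

Set Implicit Arguments.
Unset Strict Implicit.
Unset Printing Implicit Defensive.

(** * Chernoff bounds for sample means *)

(** From [1 - u <= expR (- u)] comes [expR u * (1 - u) <= 1], while [(1 + u + 2 u^2) (1 - u) = 1 +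
    u^2 (1 - 2 u)] is at least 1. *)
Lemma expR_le_quadratic (R : realType) (u : R) :
  u <= 2^-1 -> expR u <= 1 + u + 2 * u ^+ 2.
Proof.
move=> hu; have h1 := expR_ge1Dx (- u).
have h2 : expR u * expR (- u) = 1 by rewrite -expRD subrr expR0.
have h3 := expR_gt0 u; have h4 := expR_gt0 (- u).
have h5 : expR u * (1 - u) <= 1 by have := ler_wpM2l (ltW h3) h1; rewrite h2.
have h6 : 1 <= (1 + u + 2 * u ^+ 2) * (1 - u).
  have : 0 <= u ^+ 2 * (1 - 2 * u) by apply: mulr_ge0; [exact: sqr_ge0|lra].
  by lra.
have h7 : 0 < 1 - u by lra.
by rewrite -(ler_pM2r h7); exact: le_trans h5 h6.
Qed.

Lemma sum_ffun_prod (R : realType) (A : finType) (n : nat) (G : A -> R) :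
  \sum_(f : {ffun 'I_n -> A}) \prod_(i < n) G (f i) = (\sum_a G a) ^+ n.
Proof.
by rewrite -(bigA_distr_bigA (fun=> G)) prodr_const card_ord.
Qed.

Lemma is_pmf_prod (R : realType) (A : finType) (n : nat) (p : 'I_n -> A -> R) :
  (forall i, is_pmf (p i)) ->
  is_pmf (fun f : {ffun 'I_n -> A} => \prod_(i < n) p i (f i)).
Proof.
move=> hp; split=> [f|]; first by apply: prodr_ge0 => i _; case: (hp i).
by rewrite -bigA_distr_bigA big1 // => i _; case: (hp i).
Qed.

(** Chernoff: for [t > 0] the indicator of the tail is at most [expR] of [t] times the sum of the
    [c - z (f i)], whose mean factors into an [n]-th power. The base is below 1 for small [t]
    because [c - z] has negative mean. *)
Lemma sample_mean_tail (R : realType) (A : finType) (p z : A -> R) (c : R) :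
  is_pmf p -> c < \sum_a p a * z a ->
  exists2 rho : R, 0 <= rho < 1 & forall n,
    \sum_(f : {ffun 'I_n -> A} | \sum_(i < n) z (f i) <= n%:R * c)
      \prod_(i < n) p (f i) <= rho ^+ n.
Proof.
move=> [p0 p1] hc.
pose u a := c - z a; pose d := \sum_a p a * z a - c.
(* [C] dominates both [|u a|] and [d]. This [t] makes the quadratic term [2 (t C)^2] equal to half
   of the linear gain [t d], and [d <= C] keeps [t C] at most 1/4, within reach of
   [expR_le_quadratic]. *)
pose C : R := 1 + \sum_a `|u a| + d; pose t := d / (4 * C ^+ 2).
have d0 : 0 < d by rewrite subr_gt0.
have hu a : `|u a| <= C.
  rewrite /C (bigD1 a) //=.
  have : 0 <= \sum_(i | i != a) `|u i| by apply: sumr_ge0.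
  lra.
have C0 : 0 < C.
  have : 0 <= \sum_a `|u a| by apply: sumr_ge0.
  rewrite /C; lra.
have dC : d <= C.
  have : 0 <= \sum_a `|u a| by apply: sumr_ge0.
  rewrite /C; lra.
have t0 : 0 < t by rewrite divr_gt0 // mulr_gt0 // exprn_gt0.
have htd : 4 * t * C ^+ 2 = d by rewrite /t; field; rewrite gt_eqF.
have htC : t * C <= 4^-1.
  by rewrite -(ler_pM2r C0); move: htd dC; rewrite expr2; lra.
have mean_u : \sum_a p a * u a = - d.
  rewrite /u; under eq_bigr do rewrite mulrBr.
  by rewrite sumrB -mulr_suml p1 mul1r opprB.
exists (\sum_a p a * expR (t * u a)).
  apply/andP; split; first by apply: sumr_ge0 => a _; rewrite mulr_ge0 ?expR_ge0.
  have hb a : p a * expR (t * u a) <= p a + t * (p a * u a) + p a * (2 * (t * C) ^+ 2).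
    have tu : `|t * u a| <= t * C by rewrite normrM gtr0_norm // ler_pM2l.
    have h2 : (t * u a) ^+ 2 <= (t * C) ^+ 2.
      rewrite -[X in X <= _]real_normK ?num_real //.
      by rewrite lerXn2r // nnegrE // (le_trans _ tu).
    have h3 : expR (t * u a) <= 1 + t * u a + 2 * (t * u a) ^+ 2.
      apply: expR_le_quadratic; move: (ler_norm (t * u a)); lra.
    have h4 : expR (t * u a) <= 1 + t * u a + 2 * (t * C) ^+ 2 by lra.
    move: (ler_wpM2l (p0 a) h4); lra.
  apply: le_lt_trans (ler_sum _ (fun a _ => hb a)) _.
  rewrite !big_split /= p1 -mulr_sumr mean_u -mulr_suml p1.
  have : 2 * (t * C) ^+ 2 = t * d / 2 by rewrite -htd; field.
  by move: (mulr_gt0 t0 d0); lra.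
move=> n; rewrite -sum_ffun_prod big_mkcond /=; apply: ler_sum => f _.
have q0 : 0 <= \prod_(i < n) p (f i) by apply: prodr_ge0.
rewrite big_split /=; case: ifP => hf; last first.
  by apply: mulr_ge0 => //; apply: prodr_ge0 => i _; exact: expR_ge0.
rewrite -[leLHS]mulr1; apply: ler_wpM2l => //.
rewrite -expR_sum -expR0 ler_expR -mulr_sumr; apply: mulr_ge0; first exact: ltW.
by rewrite /u sumrB sumr_const card_ord subr_ge0 -mulr_natl.
Qed.

(** * Feinstein's construction and the one-shot code *)

(** The left side of the last hypothesis is a budget: output mass used up by [M] decoding sets,
    inputs outside [T], and pairs whose likelihood ratio is below [theta]. While it stays within
    [lam], the greedy choice cannot stop before [M] codewords. *)
Lemma feinstein (R : realType) (A B : finType) (P : A -> R) (W : A -> B -> R)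
    (T : pred A) (theta lam : R) (M : nat) :
  is_pmf P -> (forall a, is_pmf (W a)) -> 0 < theta -> lam <= 1 ->
  M%:R / theta + \sum_(a | ~~ T a) P a +
    \sum_a \sum_(b | W a b < theta * \sum_a' P a' * W a' b) P a * W a b <= lam ->
  exists (a : nat -> A) (g : B -> nat), forall w, (w < M)%N ->
    T (a w) /\ 1 - lam <= \sum_(b | g b == w) W (a w) b.
Proof.
move=> [P0 P1] hW theta0 lam1.
have W0 a b : 0 <= W a b by case: (hW a).
pose Q b := \sum_a' P a' * W a' b.
rewrite -/Q => hlam0.
have {hlam0} hlam : M%:R / theta + \sum_(a | ~~ T a) P a +
    \sum_a \sum_(b | W a b < theta * Q b) P a * W a b <= lam := hlam0.
have Q0 b : 0 <= Q b by apply: sumr_ge0 => a _; exact: mulr_ge0.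
have [a0 _] : exists a0 : A, true.
  case: (pickP (fun _ : A => true)) => [a0 _|A0]; first by exists a0.
  by move: P1; rewrite big_pred0 // => /eqP; rewrite eq_sym oner_eq0.
(* [g b] is the index of the decoding set containing [b]; [k <= g b] means that
   [b] is still free after [k] steps. *)
suff : forall k, (k <= M)%N -> exists (a : nat -> A) (g : B -> nat),
    \sum_(b | (g b < k)%N) Q b <= k%:R / theta /\
    forall w, (w < k)%N -> T (a w) /\ 1 - lam <= \sum_(b | g b == w) W (a w) b.
  by move=> /(_ M (leqnn M)) [a [g [_ H]]]; exists a, g.
elim=> [_|k IH kM].
  by exists (fun=> a0), (fun=> 0%N); split=> //; rewrite mul0r big_pred0.
have {IH} [a [g [hQ H]]] := IH (ltnW kM).
have [/existsP[a' /andP[Ta' ha']]|/existsPn none] := boolP [exists a', T a' &&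
    (1 - lam <= \sum_(b | (theta * Q b <= W a' b) && (k <= g b)%N) W a' b)].
  (* The free outputs above the threshold for [a'] become decoding set [k]; the other free ones are
     relabelled [k.+1], hence stay free after the next step. *)
  exists (fun w => if w == k then a' else a w),
    (fun b => if (g b < k)%N then g b else if theta * Q b <= W a' b then k else k.+1).
  split.
    rewrite (bigID (fun b => (g b < k)%N)) /= -[k.+1%:R]natr1 mulrDl mul1r lerD //.
      rewrite (eq_bigl (fun b => (g b < k)%N)) // => b.
      by case: (ltnP (g b) k) => h; rewrite ?andbT ?andbF // ltnS ltnW.
    (* The new decoding set costs at most [1 / theta] of output mass: [theta * Q <= W a'] holds on
       it and [W a'] sums to 1. *)
    rewrite -(ler_pM2l theta0) mulfV ?gt_eqF // mulr_sumr.
    case: (hW a') => _ <-; rewrite [leRHS](bigID (fun b => theta * Q b <= W a' b)) /=.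
    rewrite -[leLHS]addr0; apply: lerD; last by apply: sumr_ge0.
    rewrite big_mkcond [leRHS]big_mkcond /=; apply: ler_sum => b _.
    case: (ltnP (g b) k) => h /=; rewrite ?andbF ?andbT; first by case: ifP.
    by case: (boolP (theta * Q b <= W a' b)) => h'; rewrite ?ltnSn ?ltnn.
  move=> w; rewrite ltnS leq_eqVlt => /orP[/eqP->|wk].
    rewrite eqxx; split=> //; apply: le_trans ha' _.
    rewrite le_eqVlt; apply/orP; left; apply/eqP; apply: eq_bigl => b.
    case: (ltnP (g b) k) => h; first by rewrite andbF ltn_eqF.
    by rewrite andbT; case: (_ <= _); rewrite ?eqxx // gtn_eqF.
  rewrite (ltn_eqF wk); case: (H w wk) => Tw hw; split=> //.
  apply: le_trans hw _; rewrite le_eqVlt; apply/orP; left; apply/eqP.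
  apply: eq_bigl => b; case: (ltnP (g b) k) => h //.
  rewrite (gtn_eqF (leq_trans wk h)).
  by case: ifP => _; rewrite gtn_eqF // ltnS ltnW.
(* If no codeword can be added, the free outputs carry little probability:
   integrate the pointwise bound [key] against [P]. *)
exfalso.
have key a' : 1 <= (if T a' then 0 else 1) + \sum_(b | W a' b < theta * Q b) W a' b
    + \sum_(b | (g b < k)%N) W a' b + (1 - lam).
  have s0 (p : pred B) : 0 <= \sum_(b | p b) W a' b by apply: sumr_ge0.
  case: ifP => Ta; last first.
    move: (s0 (fun b => W a' b < theta * Q b)) (s0 (fun b => (g b < k)%N)); lra.
  move: (none a'); rewrite Ta /= -ltNge => /ltW h3.
  rewrite add0r; case: (hW a') => _ {1}<-.
  apply: le_trans (lerD (lexx _) h3).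
  rewrite big_mkcond [X in X + _ + _]big_mkcond [X in _ + X + _]big_mkcond.
  rewrite [X in _ + _ + X]big_mkcond -!big_split /=.
  apply: ler_sum => b _; move: (W0 a' b).
  by case: (ltP (W a' b)) => h1; case: (ltnP (g b) k) => h2 /=; lra.
have : \sum_a' P a' * 1 <= \sum_a' P a' * ((if T a' then 0 else 1) +
    \sum_(b | W a' b < theta * Q b) W a' b + \sum_(b | (g b < k)%N) W a' b + (1 - lam)).
  by apply: ler_sum => a' _; apply: ler_wpM2l.
rewrite -mulr_suml P1 mulr1.
under eq_bigr do rewrite !mulrDr.
rewrite !big_split /= -!mulr_suml !P1.
have -> : \sum_i P i * (if T i then 0 else 1) = \sum_(i | ~~ T i) P i.
  by rewrite [RHS]big_mkcond; apply: eq_bigr => i _; case: ifP; rewrite ?mulr0 ?mulr1.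
under [X in _ + X + _ + _]eq_bigr do rewrite mulr_sumr.
under [X in _ + X + _]eq_bigr do rewrite mulr_sumr.
rewrite [X in _ + X + _]exchange_big /=.
(* The averaged bound needs the budget at step [k] to reach [lam]; since [k < M], it is strictly
   smaller. *)
have : k%:R / theta < M%:R / theta by rewrite ltr_pM2r ?invr_gt0 // ltr_nat.
by move: hQ hlam; rewrite -[\sum_(b | (g b < k)%N) \sum_i P i * W i b]/(\sum_(b | (g b < k)%N) Q b); lra.
Qed.

(** [T] keeps the semantic words for which any set of half the conditional mass holds [M'] inputs.
    By Markov the inputs with error at most [2 * lam] form such a set, so every single message gets
    this error bound. *)
Lemma one_shot_code (R : realType) (A X B : finType) (P : A -> R) (V : A -> X -> R)
    (U : X -> B -> R) (W : A -> B -> R) (T : pred A) (theta lam : R) (M M' : nat) :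
  is_pmf P -> (forall a, is_pmf (V a)) -> (forall x, is_pmf (U x)) ->
  (forall a b, W a b = \sum_x V a x * U x b) ->
  0 < theta -> 0 < lam < 2^-1 -> (0 < M)%N ->
  (forall a, T a -> forall G : {set X},
     2^-1 <= \sum_(x in G) V a x -> (M' <= #|G|)%N) ->
  M%:R / theta + \sum_(a | ~~ T a) P a +
    \sum_a \sum_(b | W a b < theta * \sum_a' P a' * W a' b) P a * W a b <= lam ->
  exists (a : 'I_M -> A) (h : A -> 'I_M' -> X) (g : B -> 'I_M), forall w,
    injective (h (a w)) /\
    forall m, \sum_(b | g b != w) U (h (a w) m) b <= 2 * lam.
Proof.
move=> hP hV hU WE theta0 /andP[lam0 lamh] M0 hT hlam.
have V0 a x : 0 <= V a x by case: (hV a).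
have U0 x b : 0 <= U x b by case: (hU x).
have hW a : is_pmf (W a).
  split=> [b|]; first by rewrite WE; apply: sumr_ge0 => x _; exact: mulr_ge0.
  under eq_bigr do rewrite WE.
  rewrite exchange_big /=; under eq_bigr do rewrite -mulr_sumr (hU _).2 mulr1.
  exact: (hV a).2.
have lam1 : lam <= 1 by lra.
have [a [g hag]] := feinstein hP hW theta0 lam1 hlam.
have pick_x (w : 'I_M) : exists h : 'I_M' -> X, injective h /\
    forall m, \sum_(b | g b != w :> nat) U (h m) b <= 2 * lam.
  have [Tw hw] := hag w (ltn_ord w).
  pose e x := \sum_(b | g b != w :> nat) U x b.
  pose G : {set X} := [set x | e x <= 2 * lam]%SET.
  have e0 x : 0 <= e x by apply: sumr_ge0.
  have mean_e : \sum_x V (a w) x * e x <= lam.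
    under eq_bigr do rewrite mulr_sumr.
    rewrite exchange_big /=; under eq_bigr do rewrite -WE.
    have := (hW (a w)).2; rewrite (bigID (fun b => g b == w :> nat)) /=.
    by move: hw; lra.
  have markov : 2 * lam * \sum_(x in ~: G) V (a w) x <= lam.
    apply: le_trans mean_e; rewrite mulr_sumr big_mkcond /=.
    apply: ler_sum => x _; rewrite !inE; case: ifP => [|_]; last exact: mulr_ge0.
    by rewrite -ltNge => /ltW h; rewrite mulrC; exact: ler_wpM2l.
  have hG : (M' <= #|G|)%N.
    apply: hT Tw _ _; have := (hV (a w)).2; rewrite (bigID (mem G)) /=.
    rewrite -(eq_bigl _ _ (fun x => finset.in_setC x G)).
    have : \sum_(x in ~: G) V (a w) x <= 2^-1 by rewrite -(ler_pM2l lam0); lra.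
    lra.
  exists (fun m => enum_val (widen_ord hG m)); split.
    by move=> m m' /enum_val_inj /(congr1 val) /= h; exact: val_inj.
  by move=> m; have := enum_valP (widen_ord hG m); rewrite inE.
have [H hH] := choice pick_x.
(* The channel encoder sees only [a w], so [w] must be recoverable from it. Equal codewords would
   have two disjoint decoding sets, each of mass at least [1 - lam > 1/2]. *)
have a_inj : injective (fun w : 'I_M => a w).
  move=> w w' eqa; apply/eqP/negPn/negP => neq.
  have [_ h1] := hag w (ltn_ord w); have [_ h2] := hag w' (ltn_ord w').
  move: h2; rewrite -eqa => h2.
  have := (hW (a w)).2; rewrite (bigID (fun b => g b == w :> nat)) /=.
  suff : \sum_(b | g b == w' :> nat) W (a w) b <= \sum_(b | g b != w :> nat) W (a w) b.
    by lra.
  rewrite big_mkcond [leRHS]big_mkcond /=; apply: ler_sum => b _.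
  case: (eqVneq (g b) w') => [->|_]; last by case: ifP => // _; exact: (hW _).1.
  by rewrite ifT // -[X in X != _]/(val w') val_eqE eq_sym.
pose w0 := Ordinal M0.
(* The default of [odflt] is never reached on codewords; decoding an index outside the range as [w0]
   can only lower the error. *)
exists (fun w => a w), (fun s => H (odflt w0 [pick w : 'I_M | a w == s])),
  (fun b => insubd w0 (g b)) => w.
have -> : odflt w0 [pick w' : 'I_M | a w' == a w] = w.
  case: pickP => [w' /eqP /a_inj -> //|/(_ w)].
  by rewrite eqxx.
have [hinj herr] := hH w; split=> // m; apply: le_trans (herr m).
rewrite big_mkcond [leRHS]big_mkcond /=; apply: ler_sum => b _.
case: (eqVneq (g b) w) => [->|_] /=; last by case: ifP.
by rewrite valKd eqxx.
Qed.

(** * Likelihood ratios, powers of 2 and numbers of codewords *)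

Lemma powR2_log2 (R : realType) (x : R) : 0 < x -> 2 `^ log2 x = x.
Proof.
move=> x0; have ln2 : ln (2 : R) != 0 by rewrite gt_eqF // ln_gt0 // ltr1n.
by rewrite /powR pnatr_eq0 /= /log2 divfK // lnK.
Qed.

Lemma powR2_sum (R : realType) (I : finType) (z : I -> R) :
  2 `^ (\sum_i z i) = \prod_i 2 `^ z i.
Proof.
by apply: (big_morph (powR 2)) => [x y|]; rewrite ?powRr0 // powRD // pnatr_eq0 implybT.
Qed.

Lemma sum_pair_ffun (R : realType) (A B : finType) (n : nat)
    (F : {ffun 'I_n -> A * B} -> R) :
  \sum_f F f = \sum_(a : {ffun 'I_n -> A}) \sum_(b : {ffun 'I_n -> B})
    F [ffun i => (a i, b i)].
Proof.
rewrite pair_big /=.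
apply: (reindex (fun ab : {ffun 'I_n -> A} * {ffun 'I_n -> B} =>
  [ffun i => (ab.1 i, ab.2 i)])).
exists (fun f : {ffun 'I_n -> A * B} =>
  ([ffun i => (f i).1], [ffun i => (f i).2])) => [[a b]|f] _ /=.
  by congr pair; apply/ffunP => i; rewrite !ffunE.
by apply/ffunP => i; rewrite !ffunE -surjective_pairing.
Qed.

(** Taking logarithms turns the product of ratios into a sum over letter pairs, to which
    [sample_mean_tail] applies. *)
Lemma ratio_tail (R : realType) (A B : finType) (p r : A -> B -> R) (c : R) :
  (forall a b, 0 <= p a b) -> \sum_a \sum_b p a b = 1 ->
  (forall a b, 0 < p a b -> 0 < r a b) ->
  c < \sum_a \sum_b p a b * log2 (r a b) ->
  exists2 rho : R, 0 <= rho < 1 & forall n,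
    \sum_(a : {ffun 'I_n -> A})
      \sum_(b : {ffun 'I_n -> B} | \prod_i r (a i) (b i) < 2 `^ (n%:R * c))
      \prod_i p (a i) (b i) <= rho ^+ n.
Proof.
move=> p0 p1 hr hc.
have hp : is_pmf (fun ab : A * B => p ab.1 ab.2).
  by split=> [[a b]|]; [exact: p0|rewrite -(pair_bigA _ p)].
have hc' : c < \sum_(ab : A * B) p ab.1 ab.2 * log2 (r ab.1 ab.2).
  by rewrite -(pair_bigA _ (fun a b => p a b * log2 (r a b))).
have [rho rho01 H] := sample_mean_tail hp hc'; exists rho => // n.
apply: le_trans (H n); rewrite [leRHS]big_mkcond /= sum_pair_ffun.
apply: ler_sum => a _; rewrite big_mkcond; apply: ler_sum => b _.
have -> : \prod_(i < n) p ([ffun i0 => (a i0, b i0)] i).1 ([ffun i0 => (a i0, b i0)] i).2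
    = \prod_i p (a i) (b i) by apply: eq_bigr => i _; rewrite ffunE.
have -> : \sum_(i < n) log2 (r ([ffun i0 => (a i0, b i0)] i).1
    ([ffun i0 => (a i0, b i0)] i).2) = \sum_i log2 (r (a i) (b i)).
  by apply: eq_bigr => i _; rewrite ffunE.
have prod_ge0 : 0 <= \prod_i p (a i) (b i) by apply: prodr_ge0.
case: ifP => [hlt|_]; last by case: ifP.
case: ifPn => //; rewrite -ltNge => hgt.
(* A nonzero product of [p] makes every ratio positive, so logarithms can be undone and the two
   events agree; otherwise the term vanishes. *)
rewrite le_eqVlt; apply/orP; left; apply/eqP/eqP; move: hlt.
apply: contraTT => hne; rewrite -leNgt.
have -> : \prod_i r (a i) (b i) = 2 `^ (\sum_i log2 (r (a i) (b i))).
  rewrite powR2_sum; apply: eq_bigr => i _; rewrite powR2_log2 //; apply: hr.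
  by rewrite lt_def p0 andbT; move/prodf_neq0: hne; apply.
by apply: ler_powR; rewrite ?ler1n // ltW.
Qed.

Lemma powR2_gt0 (R : realType) (x : R) : 0 < 2 `^ x.
Proof. by rewrite powR_gt0. Qed.

Lemma powR2_natM (R : realType) (r : R) (n : nat) : 2 `^ (n%:R * r) = (2 `^ r) ^+ n.
Proof. by rewrite mulrC powRrM powR_mulrn // powR_ge0. Qed.

Lemma powR2_expn_lt1 (R : realType) (r c : R) :
  r < c -> 0 < 2 `^ (r - c) < 1.
Proof.
move=> rc; rewrite powR2_gt0 /powR pnatr_eq0 /= expR_lt1 pmulr_llt0 ?subr_lt0 //.
by rewrite ln_gt0 // ltr1n.
Qed.

Lemma powR2_ratio (R : realType) (r c : R) (n : nat) :
  2 `^ (n%:R * r) = (2 `^ (r - c)) ^+ n * 2 `^ (n%:R * c).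
Proof.
by rewrite -powR2_natM -powRD ?pnatr_eq0 ?implybT // -mulrDr subrK.
Qed.

Lemma ncodewords_ceil (R : realType) (r : R) (n : nat) :
  (ncodewords r n)%:R = (Num.ceil (2 `^ (n%:R * r)))%:~R :> R.
Proof.
by rewrite /ncodewords natr_absz ger0_norm // ceil_ge0 (lt_trans _ (powR2_gt0 _)) // ltrN10.
Qed.

Lemma ncodewords_gt0 (R : realType) (r : R) (n : nat) : (0 < ncodewords r n)%N.
Proof.
rewrite -(ltr_nat R) ncodewords_ceil; apply: lt_le_trans (ceil_ge _).
exact: powR2_gt0.
Qed.

Lemma ncodewords_le (R : realType) (r : R) (n k : nat) :
  2 `^ (n%:R * r) <= k%:R -> (ncodewords r n <= k)%N.
Proof.
by move=> h; rewrite -(ler_nat R) ncodewords_ceil -[k%:R]mulrz_nat ler_int ceil_le_int mulrz_nat.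
Qed.

Lemma ncodewords0 (R : realType) (n : nat) : ncodewords (0 : R) n = 1%N.
Proof.
apply/eqP; rewrite eqn_leq ncodewords_gt0 andbT; apply: ncodewords_le.
by rewrite mulr0 powRr0.
Qed.

(** As [2^(nr) >= 1], rounding up at most doubles it. *)
Lemma ncodewords_le2 (R : realType) (r : R) (n : nat) : 0 <= r ->
  (ncodewords r n)%:R <= 2 * 2 `^ (n%:R * r).
Proof.
move=> r0; have h1 : 1 <= 2 `^ (n%:R * r).
  by rewrite -[leLHS](powRr0 2); apply: ler_powR; rewrite ?ler1n ?mulr_ge0.
have := ceilB1_lt (2 `^ (n%:R * r)); rewrite intrB -ncodewords_ceil; lra.
Qed.

Lemma near_expr_lt (R : realType) (z e : R) : 0 <= z < 1 -> 0 < e ->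
  \forall n \near \oo, z ^+ n < e.
Proof.
move=> /andP[z0 z1] e0; have zn : `|z| < 1 by rewrite ger0_norm.
exact: cvgr_lt (cvg_expr zn) _ e0.
Qed.

Lemma inhabited_pmf (R : realType) (A : finType) (p : A -> R) :
  is_pmf p -> inhabited A.
Proof.
move=> [_ p1]; case: (pickP (fun _ : A => true)) => [a _|A0]; first by exists.
by move: p1; rewrite big_pred0 // => /eqP; rewrite eq_sym oner_eq0.
Qed.

(** * Single-letter quantities and fallback codes *)

Section Achievability.
Variables (R : realType) (S X Y : finType).
Variables (pS : S -> R) (pX_S : S -> X -> R) (pY_X : X -> Y -> R).
Hypothesis hS : is_pmf pS.
Hypothesis hX_S : forall s, is_pmf (pX_S s).
Hypothesis hY_X : forall x, is_pmf (pY_X x).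

Let pY_S (s : S) (y : Y) : R := \sum_x pX_S s x * pY_X x y.
Let pY (y : Y) : R := \sum_s pS s * pY_S s y.

Let pS_ge0 s : 0 <= pS s. Proof. by case: hS. Qed.
Let pX_S_ge0 s x : 0 <= pX_S s x. Proof. by case: (hX_S s). Qed.
Let pY_X_ge0 x y : 0 <= pY_X x y. Proof. by case: (hY_X x). Qed.
Let pY_S_ge0 s y : 0 <= pY_S s y.
Proof. by apply: sumr_ge0 => x _; exact: mulr_ge0. Qed.

Lemma joint_SXE s x : joint_SX pS pX_S pY_X s x = pS s * pX_S s x.
Proof. by rewrite /joint_SX /joint -mulr_sumr (hY_X x).2 mulr1. Qed.

Lemma joint_SYE s y : joint_SY pS pX_S pY_X s y = pS s * pY_S s y.
Proof. by rewrite /joint_SY /joint mulr_sumr; apply: eq_bigr => x _; rewrite mulrA. Qed.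

Lemma marg1_SX s : marg1 (joint_SX pS pX_S pY_X) s = pS s.
Proof.
rewrite /marg1; under eq_bigr do rewrite joint_SXE.
by rewrite -mulr_sumr (hX_S s).2 mulr1.
Qed.

Lemma sum_pY_S s : \sum_y pY_S s y = 1.
Proof.
rewrite exchange_big /=; under eq_bigr do rewrite -mulr_sumr (hY_X _).2 mulr1.
exact: (hX_S s).2.
Qed.

Lemma marg1_SY s : marg1 (joint_SY pS pX_S pY_X) s = pS s.
Proof.
rewrite /marg1; under eq_bigr do rewrite joint_SYE.
by rewrite -mulr_sumr sum_pY_S mulr1.
Qed.

Lemma marg2_SY y : marg2 (joint_SY pS pX_S pY_X) y = pY y.
Proof. by rewrite /marg2; under eq_bigr do rewrite joint_SYE. Qed.

Lemma cond_entropyE : cond_entropy (joint_SX pS pX_S pY_X) =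
  \sum_s \sum_x pS s * pX_S s x * log2 (pX_S s x)^-1.
Proof.
rewrite /cond_entropy -sumrN; apply: eq_bigr => s _.
rewrite -sumrN; apply: eq_bigr => x _; rewrite joint_SXE marg1_SX -mulrN.
have [->|s0] := eqVneq (pS s) 0; first by rewrite !mul0r.
have [->|x0] := eqVneq (pX_S s x) 0; first by rewrite mulr0 !mul0r.
have -> : pS s * pX_S s x / pS s = pX_S s x by rewrite mulrC mulKf.
rewrite /log2 lnV ?mulNr //.
by rewrite posrE lt_def x0 pX_S_ge0.
Qed.

(** Gibbs' inequality, from [ln v <= v - 1] at [v = 1 / (p(x|s) |X|)]. It ensures that the words of
    length [n] suffice for distinct channel codewords at rates up to H(X|S). *)
Lemma cond_entropy_le_log2_card :
  cond_entropy (joint_SX pS pX_S pY_X) <= log2 #|X|%:R.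
Proof.
have [s0] := inhabited_pmf hS; have [x0] := inhabited_pmf (hX_S s0).
have N0 : 0 < #|X|%:R :> R by rewrite ltr0n; apply/card_gt0P; exists x0.
have ln2 : 0 < ln (2 : R) by rewrite ln_gt0 // ltr1n.
have key s : \sum_x pX_S s x * log2 (pX_S s x)^-1 <= log2 #|X|%:R.
  rewrite /log2; under eq_bigr do rewrite mulrA.
  rewrite -mulr_suml ler_pM2r ?invr_gt0 // -[leRHS]mul1r
    -[X in _ <= X * _](hX_S s).2 mulr_suml.
  rewrite -subr_le0 -sumrB.
  apply: (@le_trans _ _ (\sum_x (#|X|%:R^-1 - pX_S s x))); last first.
    by rewrite sumrB (hX_S s).2 sumr_const -[_^-1 *+ _]mulr_natl mulfV ?subrr // gt_eqF.
  apply: ler_sum => x _; have [p0|p0] := eqVneq (pX_S s x) 0.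
    by rewrite p0 !mul0r !subr0 invr_ge0 ltW.
  have px : 0 < pX_S s x by rewrite lt_def p0 pX_S_ge0.
  rewrite -mulrBr lnV ?posrE // -opprD -lnM ?posrE // -lnV ?posrE ?mulr_gt0 //.
  have hv : 0 < (pX_S s x * #|X|%:R)^-1 by rewrite invr_gt0 mulr_gt0.
  have := @le_ln1Dx R ((pX_S s x * #|X|%:R)^-1 - 1); rewrite subrKC => h.
  apply: le_trans (ler_wpM2l (ltW px) (h _)) _; first by lra.
  by rewrite mulrBr mulr1 invfM mulrA mulfV // mul1r.
rewrite cond_entropyE -[leRHS]mul1r -[X in _ <= X * _]hS.2 mulr_suml; apply: ler_sum => s _.
under eq_bigr do rewrite -mulrA.
by rewrite -mulr_sumr; apply: ler_wpM2l.
Qed.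

Lemma ncodewords_le_card (r : R) (n : nat) :
  r <= cond_entropy (joint_SX pS pX_S pY_X) -> (ncodewords r n <= #|X| ^ n)%N.
Proof.
move=> hr; apply: ncodewords_le; rewrite powR2_natM natrX.
have [s0] := inhabited_pmf hS; have [x0] := inhabited_pmf (hX_S s0).
rewrite lerXn2r ?nnegrE ?powR_ge0 ?ler0n // -[leRHS]powR2_log2; last first.
  by rewrite ltr0n; apply/card_gt0P; exists x0.
by apply: ler_powR; rewrite ?ler1n // (le_trans hr) // cond_entropy_le_log2_card.
Qed.

Lemma code_exists (M M' n : nat) : (0 < M)%N -> (M' <= #|X| ^ n)%N ->
  inhabited (code S X Y M M' n).
Proof.
move=> M0 hM'; have [s0] := inhabited_pmf hS.
have hc : (M' <= #|{: {ffun 'I_n -> X}}|)%N by rewrite card_ffun card_ord.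
exists; apply: (@Code S X Y M M' n (fun=> [ffun=> s0])
  (fun _ m => enum_val (widen_ord hc m)) (fun=> Ordinal M0)).
by move=> _ m m' /enum_val_inj /(congr1 val) /= h; exact: val_inj.
Qed.

(** * Error of a code and codes of prescribed rates *)

Lemma dmc_ext_ge0 n x y : 0 <= @dmc_ext R X Y pY_X n x y.
Proof. exact: prodr_ge0. Qed.

Lemma avg_err_ge0 (M M' n : nat) (c : code S X Y M M' n) : 0 <= avg_err pY_X c.
Proof.
rewrite mulr_ge0 ?invr_ge0 //; apply: sumr_ge0 => w _.
rewrite mulr_ge0 ?invr_ge0 //; apply: sumr_ge0 => m _.
by apply: sumr_ge0 => y _; exact: dmc_ext_ge0.
Qed.

Lemma avg_err_le (M M' n : nat) (c : code S X Y M M' n) (e : R) : 0 <= e ->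
  (forall w m, \sum_(y | decode c y != w) dmc_ext pY_X (codeword c w m) y <= e) ->
  avg_err pY_X c <= e.
Proof.
move=> e0 he.
have mean_le (k : nat) (F : 'I_k -> R) : (forall i, F i <= e) ->
    k%:R^-1 * \sum_i F i <= e.
  move=> hF; case: k F hF => [|k] F hF; first by rewrite big_ord0 mulr0.
  rewrite -(ler_pM2l (ltr0Sn R k)) mulVKf ?pnatr_eq0 //.
  apply: le_trans (ler_sum _ (fun i _ => hF i)) _.
  by rewrite sumr_const card_ord -[e *+ _]mulr_natl.
by apply: (mean_le) => w; apply: (mean_le).
Qed.

(* Removing from [G] the [x] with p(x|s) > 2^(-nc) leaves probability at least
   1/4, spread over points of mass at most 2^(-nc). *)
Lemma abundant_sequences (r : R) : 0 <= r ->
  r = 0 \/ r < cond_entropy (joint_SX pS pX_S pY_X) ->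
  exists2 rho : R, 0 <= rho < 1 &
  exists T : forall n, pred {ffun 'I_n -> S},
  (forall n, \sum_(s | ~~ T n s) \prod_i pS (s i) <= 4 * rho ^+ n) /\
  \forall n \near \oo, forall s, T n s -> forall G : {set {ffun 'I_n -> X}},
    2^-1 <= \sum_(x in G) \prod_i pX_S (s i) (x i) -> (ncodewords r n <= #|G|)%N.
Proof.
move=> r0 [->|rH].
  (* Rate 0 asks for one codeword, and a set of mass at least 1/2 is nonempty. *)
  exists 0; first by rewrite lexx ltr01.
  exists (fun _ _ => true); split.
    by move=> n; rewrite big_pred0 // mulr_ge0 // exprn_ge0.
  apply: nearW => n s _ G hG; rewrite ncodewords0 card_gt0.
  by apply: contraTneq hG => ->; rewrite big_set0 -ltNge invr_gt0.
pose c := (r + cond_entropy (joint_SX pS pX_S pY_X)) / 2.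
have rc : r < c by rewrite /c; lra.
have cH : c < \sum_s \sum_x pS s * pX_S s x * log2 (pX_S s x)^-1.
  by rewrite -cond_entropyE /c; lra.
have p1 : \sum_s \sum_x pS s * pX_S s x = 1.
  by under eq_bigr do rewrite -mulr_sumr (hX_S _).2 mulr1; exact: hS.2.
have [||rho rho01 H] := @ratio_tail R S X (fun s x => pS s * pX_S s x)
  (fun s x => (pX_S s x)^-1) c _ p1 _ cH.
- by move=> s x; exact: mulr_ge0.
- move=> s x h; rewrite invr_gt0 lt_def pX_S_ge0 andbT.
  by apply: contraTneq h => ->; rewrite mulr0 ltxx.
pose V n (s : {ffun 'I_n -> S}) (x : {ffun 'I_n -> X}) : R := \prod_i pX_S (s i) (x i).
pose atyp n s (x : {ffun 'I_n -> X}) := (V n s x)^-1 < 2 `^ (n%:R * c).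
have V0 n s x : 0 <= V n s x by exact: prodr_ge0.
(* [T] bounds the conditional mass of atypical words by 1/4; Markov then yields the factor 4. *)
exists rho => //; exists (fun n s => \sum_(x | atyp n s x) V n s x <= 4^-1); split.
  move=> n; rewrite -(ler_pM2l (_ : 0 < 4^-1 :> R)) ?invr_gt0 //.
  rewrite mulrA mulVf ?pnatr_eq0 // mul1r; apply: le_trans (H n).
  rewrite mulr_sumr big_mkcond /=; apply: ler_sum => s _.
  have -> : \sum_(x : {ffun 'I_n -> X} |
      \prod_i (pX_S (s i) (x i))^-1 < 2 `^ (n%:R * c)) \prod_i (pS (s i) * pX_S (s i) (x i))
      = \prod_i pS (s i) * \sum_(x | atyp n s x) V n s x.
    rewrite mulr_sumr; apply: eq_big => x; first by rewrite /atyp /V prodfV.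
    by rewrite big_split.
  have q0 : 0 <= \prod_i pS (s i) by exact: prodr_ge0.
  case: ifP => [|_]; last by rewrite mulr_ge0 // sumr_ge0.
  by rewrite -ltNge => /ltW h; rewrite mulrC; exact: ler_wpM2l.
have /andP[z0 z1] := powR2_expn_lt1 rc.
have zlt1 : 0 <= 2 `^ (r - c) < 1 by rewrite ltW.
(* For large [n] the gap between [r] and [c] absorbs the factor 1/4 in the count [2^(nc) / 4]. *)
have := near_expr_lt zlt1 (_ : 0 < 4^-1); rewrite invr_gt0 ltr0n => /(_ isT).
apply: filterS => n hn s hs G hG; apply: ncodewords_le.
have hmany : 4^-1 <= \sum_(x in G | ~~ atyp n s x) V n s x.
  move: hG; rewrite (bigID (atyp n s)) /=.
  have : \sum_(x in G | atyp n s x) V n s x <= \sum_(x | atyp n s x) V n s x.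
    rewrite big_mkcond [leRHS]big_mkcond /=; apply: ler_sum => x _.
    by case: (x \in G) => //=; case: ifP.
  by move: hs; rewrite -/(V n s _); lra.
have hcount : \sum_(x in G | ~~ atyp n s x) V n s x <= #|G|%:R / 2 `^ (n%:R * c).
  rewrite mulr_natl -sumr_const big_mkcondr /=; apply: ler_sum => x _.
  case: ifPn => [|_]; last by rewrite invr_ge0 powR_ge0.
  rewrite /atyp -leNgt => h; have hV := lt_le_trans (powR2_gt0 _) h.
  rewrite -[leLHS]invrK lef_pV2 ?posrE ?powR2_gt0 //.
have hc0 := powR2_gt0 (n%:R * c).
rewrite (powR2_ratio _ c) -(ler_pM2r (_ : 0 < (2 `^ (n%:R * c))^-1)) ?invr_gt0 //.
by rewrite mulfK ?gt_eqF //; apply: le_trans (ltW hn) (le_trans hmany hcount).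
Qed.

(** The alternatives [r1 = 0] and [r2 = 0] cover a vanishing information bound, below which no
    nonnegative rate lies strictly. *)
Lemma achieved_below (r1 r2 : R) : 0 <= r1 -> 0 <= r2 ->
  r1 = 0 \/ r1 < mutual_info (joint_SY pS pX_S pY_X) ->
  r2 = 0 \/ r2 < cond_entropy (joint_SX pS pX_S pY_X) ->
  r2 <= cond_entropy (joint_SX pS pX_S pY_X) ->
  achieved S pY_X (r1, r2).
Proof.
move=> r10 r20 h1 h2 r2H; split=> //=.
have any n : inhabited (code S X Y (ncodewords r1 n) (ncodewords r2 n) n).
  by apply: code_exists; [exact: ncodewords_gt0|exact: ncodewords_le_card].
case: h1 => [r1E|r1I].
  (* With a single semantic the decoder cannot err, so any code will do. *)
  exists (fun n => inhabited_witness (any n)); rewrite (_ : (fun n => _) = fun=> 0); first exact: cvg_cst.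
  apply/funext => n; apply/eqP; rewrite eq_le avg_err_ge0 andbT.
  apply: avg_err_le => // w m; rewrite big_pred0 // => y; apply/negbTE/negPn/eqP.
  by move: (decode _ y) w {m}; rewrite r1E ncodewords0 => a b; rewrite !ord1.
pose c1 := (r1 + mutual_info (joint_SY pS pX_S pY_X)) / 2.
have rc : r1 < c1 by rewrite /c1; lra.
have cI : c1 < \sum_s \sum_y pS s * pY_S s y * log2 (pY_S s y / pY y).
  have -> : \sum_s \sum_y pS s * pY_S s y * log2 (pY_S s y / pY y) =
      mutual_info (joint_SY pS pX_S pY_X).
    apply: eq_bigr => s _; apply: eq_bigr => y _.
    rewrite joint_SYE marg1_SY marg2_SY.
    have [->|s0] := eqVneq (pS s) 0; first by rewrite !mul0r.
    by rewrite -mulf_div mulfV // mul1r.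
  by rewrite /c1; lra.
have p1 : \sum_s \sum_y pS s * pY_S s y = 1.
  by under eq_bigr do rewrite -mulr_sumr sum_pY_S mulr1; exact: hS.2.
have [||rho1 rho1_01 H1] := @ratio_tail R S Y (fun s y => pS s * pY_S s y)
  (fun s y => pY_S s y / pY y) c1 _ p1 _ cI.
- by move=> s y; exact: mulr_ge0.
- move=> s y h; apply: divr_gt0.
    rewrite lt_def pY_S_ge0 andbT.
    by apply: contraTneq h => ->; rewrite mulr0 ltxx.
  apply: lt_le_trans h _; rewrite /pY (bigD1 s) //= lerDl.
  by apply: sumr_ge0 => i _; exact: mulr_ge0.
have [rho2 rho2_01 [T [HT1 HT2]]] := abundant_sequences r20 h2.
have /andP[z0 z1] := powR2_expn_lt1 rc.
set z := 2 `^ (r1 - c1) in z0 z1.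
have z01 : 0 <= z < 1 by rewrite ltW.
(* Feinstein's three terms with [theta = 2^(n c1)]: the rounded number of semantics over [theta],
   the words outside [T], and the low likelihood ratios. *)
pose lam n := 2 * z ^+ n + 4 * rho2 ^+ n + rho1 ^+ n.
have lam_cvg : lam @ \oo --> (0 : R).
  have cvg0 (x k : R) : 0 <= x < 1 -> (fun n => k * x ^+ n) @ \oo --> (0 : R).
    move=> /andP[x0 x1]; rewrite -[X in _ --> X](mulr0 k).
    by apply: cvgMl_tmp; apply: cvg_expr; rewrite ger0_norm.
  rewrite -[X in _ --> X](addr0 0) -[X in _ --> X + _](addr0 0).
  apply: cvgD; first by apply: cvgD; exact: cvg0.
  by apply: cvg_expr; case/andP: rho1_01 => a0 a1; rewrite ger0_norm.
have lam_gt0 n : 0 < lam n.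
  have := exprn_gt0 n z0; case/andP: rho1_01 => a1 _; case/andP: rho2_01 => a2 _.
  by have := exprn_ge0 n a1; have := exprn_ge0 n a2; rewrite /lam; lra.
pose good n := forall s, T n s -> forall G : {set {ffun 'I_n -> X}},
  2^-1 <= \sum_(x in G) \prod_i pX_S (s i) (x i) -> (ncodewords r2 n <= #|G|)%N.
(* Stated as an implication so that a code is chosen at every [n]; the error bound matters only
   eventually. *)
have codes n : exists c : code S X Y (ncodewords r1 n) (ncodewords r2 n) n,
    good n -> lam n < 2^-1 -> avg_err pY_X c <= 2 * lam n.
  have [c0] := any n.
  have [[gn ln]|bad] := pselect (good n /\ lam n < 2^-1); last first.
    by exists c0 => gn ln; case: bad.
  pose P (s : {ffun 'I_n -> S}) : R := \prod_i pS (s i).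
  pose V (s : {ffun 'I_n -> S}) (x : {ffun 'I_n -> X}) : R := \prod_i pX_S (s i) (x i).
  pose W (s : {ffun 'I_n -> S}) (y : {ffun 'I_n -> Y}) : R := \prod_i pY_S (s i) (y i).
  have WE s y : W s y = \sum_x V s x * dmc_ext pY_X x y.
    rewrite /W /pY_S (bigA_distr_bigA (fun i x => pX_S (s i) x * pY_X x (y i))).
    by apply: eq_bigr => x _; rewrite big_split.
  have QE (y : {ffun 'I_n -> Y}) : \sum_s P s * W s y = \prod_i pY (y i).
    rewrite /pY (bigA_distr_bigA (fun i s => pS s * pY_S s (y i))).
    by apply: eq_bigr => s _; rewrite big_split.
  have hP : is_pmf P by exact: is_pmf_prod (fun=> hS).
  have hV s : is_pmf (V s) by exact: is_pmf_prod (fun i => hX_S (s i)).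
  have hU x : is_pmf (@dmc_ext R X Y pY_X n x) by exact: is_pmf_prod (fun i => hY_X (x i)).
  have hl : 0 < lam n < 2^-1 by rewrite lam_gt0.
  have th0 := powR2_gt0 (n%:R * c1).
  have [|a [h [g hag]]] := one_shot_code hP hV hU WE th0 hl (ncodewords_gt0 r1 n) gn.
    rewrite /lam; apply: lerD; first apply: lerD.
    - rewrite ler_pdivrMr // -mulrA -powR2_ratio; exact: ncodewords_le2.
    - exact: HT1.
    - apply: le_trans (H1 n); apply: ler_sum => s _.
      rewrite big_mkcond [leRHS]big_mkcond /=; apply: ler_sum => y _.
      have PW : \prod_i (pS (s i) * pY_S (s i) (y i)) = P s * W s y by rewrite big_split.
      have PW0 : 0 <= P s * W s y by rewrite mulr_ge0 // prodr_ge0.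
      rewrite PW QE big_split /= prodfV.
      (* [hlt] rules out a zero output probability, which would put [W s y] below 0; hence the ratio
         can be formed. *)
      case: ifP => [hlt|_]; last by case: ifP.
      rewrite ifT // ltr_pdivrMr // lt_def prodr_ge0 ?andbT; last first.
        by move=> i _; apply: sumr_ge0 => j _; exact: mulr_ge0.
      apply: contraTneq hlt => ->; rewrite mulr0 -leNgt; exact: prodr_ge0.
  exists (@Code S X Y _ _ n a h g (fun w => (hag w).1)) => _ _.
  apply: avg_err_le => [|w m]; first by rewrite mulr_ge0 // ltW.
  exact: (hag w).2.
exists (fun n => sval (cid (codes n))); apply: (@squeeze_cvgr _ _ _ _ (fun=> 0) (fun n => 2 * lam n)).
- have half0 : 0 < 2^-1 :> R by rewrite invr_gt0.
  near=> n; have gn : good n by near: n.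
  have ln : lam n < 2^-1 by near: n; exact: cvgr_lt lam_cvg _ half0.
  rewrite avg_err_ge0; exact: (svalP (cid (codes n))).
- exact: cvg_cst.
- by rewrite -[X in _ --> X](mulr0 2); exact: cvgMl_tmp.
Unshelve. all: by end_near.
Qed.

End Achievability.

(** * Passage to the closure *)

Unset Implicit Arguments.

Theorem theorem1 (R : realType) (S X Y : finType)
    (pS : S -> R) (pX_S : S -> X -> R) (pY_X : X -> Y -> R)
    (hS : is_pmf pS) (hX_S : forall s, is_pmf (pX_S s))
    (hY_X : forall x, is_pmf (pY_X x)) :
  achievable_region S pY_X
    [set r : R * R | [/\ 0 <= r.1, 0 <= r.2,
      r.1 <= mutual_info (joint_SY pS pX_S pY_X) &
      r.2 <= cond_entropy (joint_SX pS pX_S pY_X)]].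
Proof.
move=> [r1 r2] /= [r10 r20 r1I r2H] B /nbhs_ballP [e /= e0 hB].
(* Lowering each rate by [e / 2], but not below 0, stays in the ball of radius [e] and gives rate 0
   or a strict inequality. *)
pose back (r : R) := Num.max 0 (r - e / 2).
have back_ge0 r : 0 <= back r by rewrite /back le_max lexx.
have back_lt r m : r <= m -> back r = 0 \/ back r < m.
  move=> rm; rewrite /back; case: (leP 0 (r - e / 2)) => h; [right|left].
    lra.
  by [].
have back_le (r : R) : 0 <= r -> back r <= r by move=> r0; rewrite /back ge_max r0 /=; lra.
have back_ball (r : R) : 0 <= r -> ball r e (back r).
  move=> r0; rewrite -ball_normE /= ger0_norm ?subr_ge0 ?back_le //.
  have : r - e / 2 <= back r by rewrite /back le_max lexx orbT.
  by move: e0; lra.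
exists (back r1, back r2); split.
  apply: (achieved_below hS hX_S hY_X); rewrite ?back_ge0 //; try exact: back_lt.
  exact: le_trans (back_le _ r20) r2H.
by apply: hB; split; exact: back_ball.
Qed.
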